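(* Let $\mathcal H$ be an infinite-dimensional separable Hilbert space. Assume that $\{T^n\varphi\}_{n=0}^\infty$ is an overcomplete frame for $\mathcal H$ for some $\varphi\in\mathcal H$ and some bounded linear operator $T:\mathcal H\to\mathcal H$. Then the following hold: (i) The image chain of $T$ has finite length $q(T)$. (ii) If $N\in\mathbb N_0$, then $T^N\varphi\in\overline{\mathrm{span}}\{T^n\varphi\}_{n=N+1}^\infty$ if and only if $N\ge q(T)$. For any $N\ge q(T)$, let $V:=\overline{\mathrm{span}}\{T^n\varphi\}_{n=N}^\infty$. Then the following hold: (iii) The space $V$ is independent of $N$ (for $N\ge q(T)$) and has finite codimension in $\mathcal H$. (iv) The sequence $\{T^n\varphi\}_{n=N+\ell}^\infty$ is a frame for $V$ for all $\ell\in\mathbb N_0$. (v) $V$ is invariant under $T$, and $T:V\to V$ is surjective. (vi) If the null chain of $T$ has finite length, then $T:V\to V$ is injective; in particular this is the case if $T$ is normal.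
   Context: $\mathbb N_0=\{0,1,2,\dots\}$, and $\overline{\mathrm{span}}$ denotes the closed linear span. A sequence $\{f_k\}$ in a Hilbert space $\mathcal K$ is a frame for $\mathcal K$ if there exist constants $A,B>0$ such that $A\|f\|^2\le\sum_k|\langle f,f_k\rangle|^2\le B\|f\|^2$ for all $f\in\mathcal K$. A frame is a Riesz basis if and only if it is $\omega$-independent, i.e. $\sum_k c_kf_k=0$ only if all $c_k=0$; a frame is overcomplete if it is not a Riesz basis, equivalently if there is a nonzero square-summable scalar sequence $\{c_k\}$ with $\sum_kc_kf_k=0$. For an operator $T:\mathcal H\to\mathcal H$ let $\mathcal N(T^n)$ and $\mathcal R(T^n)$ denote the null space and range of $T^n$, $n\in\mathbb N_0$ ($T^0$ is the identity). The null chain of $T$ is the increasing sequence $\mathcal N(T^0)\subseteq\mathcal N(T)\subseteq\mathcal N(T^2)\subseteq\cdots$; it is finite (has finite length) if there is $N\in\mathbb N_0$ with $\mathcal N(T^N)=\mathcal N(T^{N+1})$, and the smallest such $N$ is its length. The image chain of $T$ is the decreasing sequence $\mathcal R(T^0)\supseteq\mathcal R(T)\supseteq\mathcal R(T^2)\supseteq\cdots$; it is finite (has finite length) if there is $N\in\mathbb N_0$ with $\mathcal R(T^N)=\mathcal R(T^{N+1})$, and the smallest such $N$ is its length, denoted $q(T)$. *)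

(* Defs.v *)
From HB Require Import structures.
From mathcomp Require Import all_boot all_order all_algebra.
From mathcomp Require Import all_classical all_reals all_analysis.
From mathcomp Require Import complex.

Set Implicit Arguments.
Unset Strict Implicit.
Unset Printing Implicit Defensive.

Import Order.TTheory GRing.Theory Num.Theory.
Import numFieldNormedType.Exports.

Local Open Scope classical_set_scope.
Local Open Scope ring_scope.

(* The scalar field of a Hilbert space, together with its conjugation, is
   either the real field R (trivial conjugation) or the complex field R[i]. *)
Inductive hilbert_scalars (R : realType) :
    forall K : numFieldType, (K -> K) -> Prop :=
  | RealScalars : @hilbert_scalars R R idfun
  | ComplexScalars : @hilbert_scalars R R[i] (@conjc R).

Section Spans.
Variables (K : numFieldType) (H : normedModType K).

Definition span (A : set H) : set H :=
  [set x | exists (n : nat) (c : 'I_n -> K) (v : 'I_n -> H),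
             (forall i, A (v i)) /\ x = \sum_(i < n) c i *: v i].

Definition closed_span (A : set H) : set H := closure (span A).

Definition infinite_dimensional : Prop :=
  forall s : seq H, span [set` s] <> setT.

(* The quotient H / V is spanned by the classes of finitely many vectors. *)
Definition finite_codimension (V : set H) : Prop :=
  exists s : seq H, forall x, exists2 v, V v & span [set` s] (x - v).

Definition separable : Prop :=
  exists2 D : set H, countable D & dense D.

End Spans.

Arguments infinite_dimensional {K} H.
Arguments separable {K} H.

Section Operators.
Variables (K : numFieldType) (H : normedModType K) (T : H -> H).

Definition bounded_operator : Prop :=
  exists M : K, forall x, `|T x| <= M * `|x|.

Definition null_chain (n : nat) : set H := [set x | iter n T x = 0].

Definition image_chain (n : nat) : set H := range (iter n T).

Definition tail_span (phi : H) (N : nat) : set H :=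
  closed_span [set iter n T phi | n in [set n | (N <= n)%N]].

End Operators.

Section Chains.
Variables (X : Type) (C : nat -> set X).

Definition finite_chain : Prop := exists N, C N = C N.+1.

Definition chain_length (N : nat) : Prop :=
  C N = C N.+1 /\ forall M, C M = C M.+1 -> (N <= M)%N.

End Chains.

Section Frames.
Variables (K : numFieldType) (conj : K -> K) (H : normedModType K).
Variable dot : {dot H for conj}.

(* f is a frame for the closed subspace V, regarded as a Hilbert space. *)
Definition frame (V : set H) (f : nat -> H) : Prop :=
  (forall k, V (f k)) /\
  exists A B : K, [/\ 0 < A, 0 < B &
    forall x, V x ->
      let u := series (fun k => `|dot x (f k)| ^+ 2) in
      [/\ cvgn u, A * `|x| ^+ 2 <= limn u & limn u <= B * `|x| ^+ 2]].

Definition omega_independent (f : nat -> H) : Prop :=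
  forall c : nat -> K,
    series (fun k => c k *: f k) @ \oo --> (0 : H) -> forall k, c k = 0.

Definition riesz_basis (V : set H) (f : nat -> H) : Prop :=
  frame V f /\ omega_independent f.

Definition overcomplete_frame (V : set H) (f : nat -> H) : Prop :=
  frame V f /\ ~ riesz_basis V f.

Definition adjoint (T S : H -> H) : Prop :=
  forall x y, dot (T x) y = dot x (S y).

Definition normal_operator (T : H -> H) : Prop :=
  exists2 S, adjoint T S & forall x, T (S x) = S (T x).

End Frames.

(* Main.v *)
Require Import Defs.
From HB Require Import structures.
From mathcomp Require Import all_boot all_order all_algebra.
From mathcomp Require Import all_classical all_reals all_analysis.
From mathcomp Require Import complex ring.

(** Write [f k = T^k phi] and let [V_N] be the closed span of the tail
    [f_N, f_(N+1), ...]. Everything follows from the identity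

      range (T^N) = V_N   for every N                  ([image_tail_span]),

    which turns statements about the image chain into statements about tails
    of the orbit. In particular [T^N phi] lies in [V_(N+1)] if and only if
    [V_N = V_(N+1)], that is, if and only if the image chain is stationary at
    [N], so [q(T)] is the first such [N]. One exists because overcompleteness
    gives a nontrivial relation [sum_k c_k f_k = 0]: if [c_m] is its first
    nonzero coefficient, solving for [f_m] puts it into [V_(m+1)]. From [q(T)]
    on, [V] is the range of all large powers of [T], whence [T V = V]; and if
    [x = T^p z] is killed by [T] while the null chain stops at [p], then
    [T^p z = 0], so [T] is injective on [V]. A normal operator has
    [ker T = ker T^2].

    The identity has two ingredients.

    First, each tail is a frame for its closed span. Upper bounds are
    inherited, so only the lower bound matters, and it suffices to remove one
    vector at a time ([lower_bound_drop_first]). If the lower bound is lost,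
    there are vectors [y_j] with [<y_j, f_0> = 1] that are asymptotically
    orthogonal to the remaining vectors; the old lower bound makes [(y_j)] a
    Cauchy sequence, and its limit [y] satisfies [<y, f_0> = 1] and is
    orthogonal to [f_1, f_2, ...]. Inside the closed span of [f_1, f_2, ...]
    no such [y] exists. Applied to the whole space, the same alternative shows
    that the line through [phi] and the range of [T] together span everything
    ([orbit_decomposition]), which gives the finite codimension.

    Second, if [L f_k] is a frame for a closed subspace [W], then [L] maps onto
    [W] ([lower_bound_onto]). For [x] in [W], a finite section
    [y = B^-1 sum_(k < n) <x, L f_k> f_k] of the frame expansion satisfies
    [|y| <= |x|] and [|x - L y| <= r |x|] with a fixed [r < 1]; iterating on
    the residual gives an exact preimage. Taking [L = T^N] shows that [V_N] is
    contained in the range of [T^N]; taking [L = id] shows that the orbit spans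
    a dense subspace, from which the other inclusion follows by continuity.

    Frame bounds are handled through finite partial sums of squared
    coefficients, and the scalar field enters only through the identity
    [a * conj a = |a|^2] and the archimedean property, so that the real and
    the complex case are treated at once. *)

Import Order.TTheory GRing.Theory Num.Theory.
Import numFieldNormedType.Exports.
Local Open Scope classical_set_scope.
Local Open Scope ring_scope.

Set Implicit Arguments.
Unset Strict Implicit.
Unset Printing Implicit Defensive.

(** * Scalars *)

Definition archimedean_scalars (K : numFieldType) :=
  forall x : K, 0 <= x -> exists n : nat, x < n%:R.

Lemma hilbert_scalars_norm (R : realType) (K : numFieldType) (conj : K -> K) :
  hilbert_scalars R conj -> forall x, x * conj x = `|x| ^+ 2.
Proof.
case=> x; last by rewrite sqr_normc.
by rewrite /= real_normK ?num_real// expr2.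
Qed.

Lemma hilbert_scalars_archimedean (R : realType) (K : numFieldType)
    (conj : K -> K) : hilbert_scalars R conj -> archimedean_scalars K.
Proof.
case=> x x0; first by exists (Num.bound x); exact: archi_boundP.
case: x x0 => a b; rewrite lecE /= => /andP[/eqP -> a0].
exists (Num.bound a); rewrite -(rmorph_nat (@real_complex R)) ltcR.
exact: archi_boundP.
Qed.

Lemma archi_invr (K : numFieldType) (e : K) : archimedean_scalars K -> 0 < e ->
  exists N : nat, forall n, (N <= n)%N -> n.+1%:R^-1 < e.
Proof.
move=> archi e0; have [N hN] := archi _ (ltW (etrans (invr_gt0 e) e0)).
exists N => n Nn; rewrite invf_plt ?posrE ?ltr0n//.
by rewrite (lt_le_trans hN)// ler_nat ltnW.
Qed.

(** * Closed subspaces and closed spans *)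

Section Closure.
Variables (K : numFieldType) (H : normedModType K).
Implicit Types (A W : set H) (x y : H).

Lemma closureP A x :
  closure A x <-> forall e : K, 0 < e -> exists2 a, A a & `|x - a| < e.
Proof.
split=> [clA e e0|hA B /nbhs_ballP[e /= e0 eB]].
  have /clA[a [Aa]] : nbhs x (ball x e) by exact: nbhsx_ballx.
  by rewrite -ball_normE /= => ax; exists a.
have [a Aa ax] := hA _ e0; exists a; split=> //; apply: eB.
by rewrite -ball_normE.
Qed.

Definition closed_subspace W :=
  [/\ W 0, forall a x y, W x -> W y -> W (a *: x + y) & closed W].

Section SubspaceTheory.
Variable W : set H.
Hypothesis cW : closed_subspace W.

Lemma subspaceZD a x y : W x -> W y -> W (a *: x + y).
Proof. by case: cW => _ + _; apply. Qed.

Lemma subspaceZ a x : W x -> W (a *: x).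
Proof. by move=> Wx; rewrite -[_ *: _]addr0; apply: subspaceZD=> //; case: cW. Qed.

Lemma subspaceD x y : W x -> W y -> W (x + y).
Proof. by move=> Wx Wy; rewrite -[x]scale1r; exact: subspaceZD. Qed.

Lemma subspaceB x y : W x -> W y -> W (x - y).
Proof. by move=> Wx Wy; rewrite addrC -scaleN1r; exact: subspaceZD. Qed.

Lemma subspace_sum n (v : nat -> H) : (forall i, W (v i)) ->
  W (\sum_(i < n) v i).
Proof.
move=> Wv; elim: n => [|n IH]; first by rewrite big_ord0; case: cW.
by rewrite big_ord_recr; exact: subspaceD.
Qed.

Lemma subspace_closure x :
  (forall e : K, 0 < e -> exists2 a, W a & `|x - a| < e) -> W x.
Proof. by case: cW => _ _ + /closureP; apply. Qed.

End SubspaceTheory.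

Lemma span_incl A : A `<=` Defs.span A.
Proof.
by move=> x Ax; exists 1%N, (fun=> 1), (fun=> x); rewrite big_ord1 scale1r.
Qed.

Lemma span_subspace A : Defs.span A 0 /\
  forall a x y, Defs.span A x -> Defs.span A y -> Defs.span A (a *: x + y).
Proof.
split; first by exists 0%N, (fun=> 0), (fun=> 0); rewrite big_ord0; split=> // -[].
move=> a x y [n [c [v [Av ->]]]] [m [d [w [Aw ->]]]].
exists (n + m)%N,
  (fun i => match fintype.split i with inl j => a * c j | inr j => d j end),
  (fun i => match fintype.split i with inl j => v j | inr j => w j end).
split=> [i|]; first by case: (fintype.split i).
rewrite big_split_ord /= scaler_sumr; congr (_ + _); apply: eq_bigr => i _.
- by rewrite -[lshift m i]/(unsplit (inl i)) unsplitK scalerA.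
- by rewrite -[rshift n i]/(unsplit (inr i)) unsplitK.
Qed.

Lemma span_min A W : closed_subspace W -> A `<=` W -> Defs.span A `<=` W.
Proof.
move=> cW AW x [n [c [v [Av ->]]]]; case: (cW) => W0 WZ _.
by elim/big_rec: _ => // i y _ Wy; apply: WZ=> //; exact: AW.
Qed.

Lemma closed_span_subspace A : closed_subspace (closed_span A).
Proof.
have [s0 sZ] := span_subspace A.
split; [exact: subset_closure|move=> a x y|exact: closed_closure].
move=> /closureP Ax /closureP Ay; apply/closureP=> e e0.
have a1 : 0 < `|a| + 1 by rewrite ltr_wpDl.
have [x' Ax' xx'] := Ax (e / 2 / (`|a| + 1)) ltac:(by rewrite !divr_gt0).
have [y' Ay' yy'] := Ay (e / 2) ltac:(by rewrite divr_gt0).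
exists (a *: x' + y'); first exact: sZ.
rewrite opprD addrACA -scalerBr (le_lt_trans (ler_normD _ _))//.
rewrite [e in _ < e]splitr ler_ltD// normrZ.
rewrite (@le_trans _ _ ((`|a| + 1) * `|x - x'|)) ?ler_wpM2r ?lerDl//.
by rewrite mulrC -ler_pdivlMr// ltW.
Qed.

Lemma closed_span_incl A : A `<=` closed_span A.
Proof. by move=> x Ax; exact/subset_closure/span_incl. Qed.

Lemma closed_span_min A W : closed_subspace W -> A `<=` W -> closed_span A `<=` W.
Proof.
move=> cW AW x /closureP hx; apply: (subspace_closure cW) => e /hx[a sa ax].
by exists a => //; exact: span_min sa.
Qed.

Lemma closed_spanS A B : A `<=` B -> closed_span A `<=` closed_span B.
Proof.
move=> AB; apply: closed_span_min; first exact: closed_span_subspace.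
by move=> x /AB; exact: closed_span_incl.
Qed.

Lemma setT_subspace : closed_subspace (@setT H).
Proof. by split=> //; exact: closedT. Qed.

End Closure.

Lemma cauchy_seq_limit (K : numFieldType) (H : completeNormedModType K)
    (u : nat -> H) :
  (forall e : K, 0 < e -> exists N, forall i j, (N <= i)%N -> (N <= j)%N ->
     `|u i - u j| < e) ->
  exists l, forall e : K, 0 < e ->
    exists N, forall i, (N <= i)%N -> `|l - u i| < e.
Proof.
move=> hu; suff /cvg_ex[l /cvgrPdist_lt ul] : cvgn u.
  by exists l => e /ul[N _ hN]; exists N => i /hN.
apply/cauchy_cvgP/cauchy_exP => e /hu[N hN]; exists (u N), N => // i Ni.
by rewrite /= -ball_normE /=; exact: hN.
Qed.

(** * Inner product spaces *)

Section InnerProduct.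
Variables (K : numFieldType) (conj : K -> K) (H : completeNormedModType K).
Variable dot : {dot H for conj}.
Hypothesis conjM : forall a, a * conj a = `|a| ^+ 2.
Hypothesis archi : archimedean_scalars K.
Hypothesis hdot : forall x : H, dot x x = `|x| ^+ 2.
Implicit Types (x y : H) (f g : nat -> H) (W : set H).

Lemma dotC x y : dot x y = conj (dot y x).
Proof.
have herm (f : {hermitian H for false & conj}) :
    f x y = (-1) ^+ false * conj (f y x).
  by case: f => ? [[? ? ? ?] []].
by rewrite herm mul1r.
Qed.

Lemma dot0l x : dot 0 x = 0. Proof. exact: linear0l. Qed.

Lemma dot0r x : dot x 0 = 0. Proof. exact: linear0r. Qed.

Lemma dotDl x y z : dot (x + y) z = dot x z + dot y z.
Proof. exact: linearDl. Qed.

Lemma dotDr x y z : dot x (y + z) = dot x y + dot x z.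
Proof. exact: linearDr. Qed.

Lemma dotBl x y z : dot (x - y) z = dot x z - dot y z.
Proof. exact: linearBl. Qed.

Lemma dotZl a x y : dot (a *: x) y = a * dot x y.
Proof. by rewrite linearZl_LR. Qed.

Lemma dotZr a x y : dot x (a *: y) = conj a * dot x y.
Proof. by rewrite linearZr_LR. Qed.

Lemma conj0 : conj 0 = 0.
Proof. by rewrite -{1}(dot0l 0) -dotC dot0l. Qed.

Lemma conj_norm a : `|conj a| = `|a|.
Proof.
have [->|a0] := eqVneq a 0; first by rewrite conj0.
apply: (@mulfI _ `|a|); first by rewrite normr_eq0.
by rewrite -normrM conjM normrX normr_id.
Qed.

Lemma conj_gt0 a : 0 < a -> conj a = a.
Proof.
move=> a0; apply: (@mulfI _ a); first by rewrite gt_eqF.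
by rewrite conjM gtr0_norm.
Qed.

Lemma dot_normC x y : `|dot x y| = `|dot y x|.
Proof. by rewrite dotC conj_norm. Qed.

Lemma normD_sqr x y :
  `|x + y| ^+ 2 = `|x| ^+ 2 + `|y| ^+ 2 + (dot x y + dot y x).
Proof. by rewrite -!hdot dotDl !dotDr; ring. Qed.

Lemma normB_sqr x y :
  `|x - y| ^+ 2 = `|x| ^+ 2 + `|y| ^+ 2 - (dot x y + dot y x).
Proof.
by rewrite normD_sqr normrN linearNr linearNl opprD.
Qed.

Lemma normD_orth x y : dot x y = 0 -> `|x + y| ^+ 2 = `|x| ^+ 2 + `|y| ^+ 2.
Proof.
move=> xy; have yx : dot y x = 0.
  by apply/eqP; rewrite -normr_eq0 dot_normC xy normr0.
by rewrite normD_sqr xy yx !addr0.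
Qed.

Lemma dot_sumr n x (v : nat -> H) :
  dot x (\sum_(i < n) v i) = \sum_(i < n) dot x (v i).
Proof. exact: raddf_sum. Qed.

Lemma dot_suml n x (v : nat -> H) :
  dot (\sum_(i < n) v i) x = \sum_(i < n) dot (v i) x.
Proof. exact: linear_sumlz. Qed.

Lemma dot_bounded x y : `|dot x y| <= `|x| * `|y|.
Proof.
have [->|y0] := eqVneq y 0; first by rewrite dot0r !normr0 mulr0.
have n0 : 0 < `|y| by rewrite normr_gt0.
set p := (dot x y / `|y| ^+ 2) *: y.
have y2 : `|y| ^+ 2 != 0 by rewrite expf_neq0 // gt_eqF.
have /normD_orth : dot (x - p) p = 0.
  by rewrite {2}/p dotZr dotBl dotZl hdot divfK ?subrr ?mulr0.
rewrite subrK => xp; have : `|p| ^+ 2 <= `|x| ^+ 2 by rewrite xp lerDr exprn_ge0.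
rewrite ler_sqr ?qualifE/= ?normr_ge0// normrZ normrM normfV normrX normr_id.
by rewrite expr2 invfM mulrA divfK ?gt_eqF// ler_pdivrMr.
Qed.

Lemma dot_limit_eq l z c :
  (forall e : K, 0 < e -> exists2 x, `|l - x| < e & `|dot x z - c| < e) ->
  dot l z = c.
Proof.
move=> hl; apply/eqP; rewrite -subr_eq0 -normr_eq0; apply/eqP/le_anti.
rewrite normr_ge0 andbT; apply/ler_addgt0Pl => e e0; rewrite addr0.
have z1 : 0 < `|z| + 1 by rewrite ltr_wpDl.
have [x lx xc] := hl (e / (`|z| + 1)) ltac:(by rewrite divr_gt0).
rewrite -[_ - c](subrKA (dot x z)) -dotBl (le_trans (ler_normD _ _))//.
have -> : e = e / (`|z| + 1) * `|z| + e / (`|z| + 1).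
  by rewrite -[X in _ + X]mulr1 -mulrDr divfK ?gt_eqF.
by rewrite lerD ?(ltW xc)// (le_trans (dot_bounded _ _))// ler_wpM2r// ltW.
Qed.

Lemma dot_closed_span_eq0 (A : set H) y :
  (forall a, A a -> dot a y = 0) -> forall x, closed_span A x -> dot x y = 0.
Proof.
move=> Ay; apply: closed_span_min; last exact: Ay.
split; first exact: dot0l.
  by move=> a x z xy zy; rewrite dotDl dotZl xy zy mulr0 addr0.
move=> x /closureP xcl; apply: dot_limit_eq => e e0.
by have [a /= ay xa] := xcl e e0; exists a => //; rewrite ay subrr normr0.
Qed.

(** * Frame bounds through partial sums *)

Definition frame_sum f n x := \sum_(k < n) `|dot x (f k)| ^+ 2.

Definition bessel B f := forall x n, frame_sum f n x <= B * `|x| ^+ 2.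

(** A partial sum already reaching [A * |x|^2] is equivalent, up to shrinking
    [A], to the lower frame inequality, and avoids limits in the scalars. *)
Definition lower_bound A W f :=
  forall x, W x -> exists n, A * `|x| ^+ 2 <= frame_sum f n x.

Lemma frame_sum_ge0 f n x : 0 <= frame_sum f n x.
Proof. by apply: sumr_ge0 => k _; rewrite exprn_ge0. Qed.

Lemma frame_sumZ f n a x : frame_sum f n (a *: x) = `|a| ^+ 2 * frame_sum f n x.
Proof.
by rewrite mulr_sumr; apply: eq_bigr => k _; rewrite dotZl normrM exprMn.
Qed.

Lemma frame_sum_recl f n x :
  frame_sum f n.+1 x = `|dot x (f 0%N)| ^+ 2 + frame_sum (fun k => f k.+1) n x.
Proof. by rewrite /frame_sum big_ord_recl. Qed.

Lemma frame_sumB f n x y :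
  frame_sum f n (x - y) <= (frame_sum f n x + frame_sum f n y) *+ 2.
Proof.
rewrite /frame_sum -big_split /= -sumrMnl; apply: ler_sum => k _; rewrite dotBl.
set a := dot x _; set b := dot y _.
have ab : `|a| * `|b| *+ 2 <= `|a| ^+ 2 + `|b| ^+ 2.
  by rewrite real_leif_mean_square_scaled ?normr_real.
apply: (@le_trans _ _ ((`|a| + `|b|) ^+ 2)).
  by rewrite ler_sqr ?qualifE/= ?addr_ge0// ler_normB.
by rewrite sqrrD addrAC mulr2n lerD2l.
Qed.

Lemma lower_boundS A W W' f :
  W' `<=` W -> lower_bound A W f -> lower_bound A W' f.
Proof. by move=> W'W lb x /W'W; exact: lb. Qed.

(** The synthesis operator is adjoint to the analysis operator, so it has the
    same norm; with [v] the synthesized vector, [|v|^2] is the sum of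
    [c_k <f_k, v>], and the arithmetic-geometric mean inequality with weights
    [B] and [1] bounds it by half of [B * sum |c_k|^2 + |v|^2]. *)
Lemma bessel_synthesis B f n (c : nat -> K) : 0 < B -> bessel B f ->
  `|\sum_(k < n) c k *: f k| ^+ 2 <= B * \sum_(k < n) `|c k| ^+ 2.
Proof.
move=> B0 hB; set v := \sum_(k < n) c k *: f k.
have v_le : `|v| ^+ 2 <= \sum_(k < n) `|c k| * `|dot v (f k)|.
  have -> : `|v| ^+ 2 = `|dot v v| by rewrite hdot ger0_norm ?exprn_ge0.
  rewrite {2}/v (dot_sumr _ _ (fun k => c k *: f k)).
  apply: (le_trans (ler_norm_sum _ _ _)); apply: ler_sum => k _.
  by rewrite dotZr normrM conj_norm.
have agm : (B * \sum_(k < n) `|c k| * `|dot v (f k)|) *+ 2 <=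
    B ^+ 2 * (\sum_(k < n) `|c k| ^+ 2) + frame_sum f n v.
  rewrite !mulr_sumr -big_split /= -sumrMnl; apply: ler_sum => k _.
  rewrite mulrA -exprMn real_leif_mean_square_scaled ?normr_real//.
  by rewrite realM ?normr_real ?gtr0_real.
have : (B * `|v| ^+ 2) *+ 2 <= B ^+ 2 * (\sum_(k < n) `|c k| ^+ 2) + B * `|v| ^+ 2.
  rewrite (le_trans _ (lerD (lexx _) (hB v n)))// (le_trans _ agm)//.
  by rewrite lerMn2r /= ler_wpM2l// ltW.
by rewrite mulr2n lerD2r expr2 -mulrA ler_pM2l.
Qed.

(** Vectors violating smaller and smaller bounds for the shortened family,
    normalized so that their coefficient on [f 0] is 1, converge to [y]. The
    vector [y] is excluded when [W] is the closed span of the shortened family,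
    and splits off the line through [f 0] when [W] is the whole space. *)
Lemma lower_bound_drop_first W f A :
  closed_subspace W -> 0 < A -> lower_bound A W f ->
  (exists2 A', 0 < A' & lower_bound A' W (fun k => f k.+1)) \/
  (exists2 y, W y & dot y (f 0%N) = 1 /\ forall k, dot y (f k.+1) = 0).
Proof.
move=> cW A0 lb; set f' := fun k => f k.+1.
have [?|noA] := pselect (exists2 A', 0 < A' & lower_bound A' W f'); first by left.
right.
(* The bound [A / (j + 2)] fails; the shift keeps it at most [A / 2], so that
   the coefficient on [f 0] carries at least half of the old lower bound. *)
have /choice[x xP] j : exists x, W x /\ forall n,
    frame_sum f' n x < A / j.+2%:R * `|x| ^+ 2.
  apply: contrapT => nox; apply: noA; exists (A / j.+2%:R).
    by rewrite divr_gt0 ?ltr0n.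
  move=> x Wx; apply: contrapT => non; apply: nox; exists x; split=> // n.
  rewrite real_ltNge ?ger0_real ?frame_sum_ge0 ?mulr_ge0 ?divr_ge0//
    ?exprn_ge0 ?(ltW A0) ?ler0n//.
  by apply/negP => hn; apply: non; exists n.
pose b j := dot (x j) (f 0%N).
have x0 j : 0 < `|x j| ^+ 2.
  have [_ /(_ 0%N)] := xP j; rewrite /frame_sum big_ord0 pmulr_rgt0//.
  by rewrite divr_gt0 ?ltr0n.
have b0 j : A / 2 * `|x j| ^+ 2 < `|b j| ^+ 2.
  have [Wx small] := xP j; have [[|n]] := lb _ Wx.
    by rewrite /frame_sum big_ord0 pmulr_rle0// lt_geF.
  rewrite frame_sum_recl -lerBlDr => hb; apply: lt_le_trans hb.
  rewrite ltrBrDr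
    (@lt_le_trans _ _ (A / 2 * `|x j| ^+ 2 + A / j.+2%:R * `|x j| ^+ 2))
    ?ltrD2l//.
  rewrite -mulrDl ler_pM2r// [leRHS](splitr A) lerD2l ler_pM2l//.
  by rewrite lef_pV2 ?posrE ?ltr0n// ler_nat.
have nb0 j : 0 < `|b j| ^+ 2.
  by apply: le_lt_trans (b0 j); rewrite !mulr_ge0 ?invr_ge0 ?ler0n// ltW.
pose y j := (b j)^-1 *: x j.
have Wy j : W (y j) by apply: subspaceZ=> //; have [] := xP j.
have y1 j : dot (y j) (f 0%N) = 1.
  by rewrite dotZl mulVf// -normr_eq0 -sqrf_eq0 gt_eqF.
have ysmall j n : frame_sum f' n (y j) <= 2 / j.+2%:R.
  rewrite frame_sumZ normfV exprVn mulrC ler_pdivrMr// ltW//.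
  have [_ /(_ n)] := xP j; move=> /lt_le_trans; apply.
  rewrite mulrAC [leRHS]mulrAC ler_wpM2r ?invr_ge0 ?ler0n//.
  by rewrite -ler_pdivrMl ?ltr0n// mulrA (mulrC 2^-1) ltW.
(* The coefficient of [y i - y j] on [f 0] vanishes, so the old lower bound
   controls this difference by the other coefficients, which are small. *)
have ydiff N i j : (N <= i)%N -> (N <= j)%N ->
    A * `|y i - y j| ^+ 2 <= 8 / N.+1%:R.
  move=> Ni Nj; have [[|n] hn] := lb _ (subspaceB cW (Wy i) (Wy j)).
    by rewrite (le_trans hn)// /frame_sum big_ord0 divr_ge0 ?ler0n.
  apply: (le_trans hn); rewrite frame_sum_recl dotBl !y1 subrr normr0 expr0n add0r.
  apply: (le_trans (frame_sumB _ _ _ _)).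
  have small k : (N <= k)%N -> frame_sum f' n (y k) <= 2 / N.+1%:R.
    move=> Nk; apply: (le_trans (ysmall k n)).
    by rewrite ler_pM2l ?ltr0n// lef_pV2 ?posrE ?ltr0n// ler_nat ltnW.
  rewrite (_ : 8 / _ = (2 / N.+1%:R + 2 / N.+1%:R) *+ 2); last by ring.
  by rewrite lerMn2r /= lerD ?small.
have [e e0|l yl] := @cauchy_seq_limit K H y.
  have eA : 0 < A * e ^+ 2 / 8 by rewrite divr_gt0 ?mulr_gt0 ?exprn_gt0.
  have [N hN] := archi_invr archi eA.
  exists N => i j Ni Nj; rewrite -ltr_sqr ?qualifE/= ?normr_ge0 ?(ltW e0)//.
  rewrite -(ltr_pM2l A0) (le_lt_trans (ydiff _ _ _ Ni Nj))//.
  by rewrite mulrC -ltr_pdivlMr ?ltr0n// hN.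
exists l.
  by apply: (subspace_closure cW) => e /yl[N hN]; exists (y N) => //; exact: hN.
split=> [|k]; apply: dot_limit_eq => e e0; have [N hN] := yl _ e0.
  by exists (y N); rewrite ?hN// y1 subrr normr0.
have e2 : 0 < e ^+ 2 / 2 by rewrite divr_gt0 ?exprn_gt0.
have [M hM] := archi_invr archi e2.
exists (y (maxn N M)); first by rewrite hN ?leq_maxl.
rewrite subr0 -ltr_sqr ?qualifE/= ?normr_ge0 ?(ltW e0)//.
apply: (@le_lt_trans _ _ (frame_sum f' k.+1 (y (maxn N M)))).
  by rewrite /frame_sum big_ord_recr /= lerDr sumr_ge0// => i _; rewrite exprn_ge0.
apply: (le_lt_trans (ysmall _ _)).
by rewrite mulrC -ltr_pdivlMr ?ltr0n// hM// leqW// leq_maxr.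
Qed.

(** * Frames and their bounds *)

(** A limit [l] of eventually nonnegative scalars satisfies [l = |l|]; this
    covers complex scalars, whose order is only partial. *)
Lemma lim_ge0 (u : nat -> K) l N : u @ \oo --> l ->
  (forall n, (N <= n)%N -> 0 <= u n) -> 0 <= l.
Proof.
move=> /cvgrPdist_lt ul u0; suff -> : l = `|l| by [].
apply/eqP; rewrite -subr_eq0 -normr_eq0; apply/eqP/le_anti.
rewrite normr_ge0 andbT; apply/ler_addgt0Pl => e e0; rewrite addr0.
have [M _ hM] := ul (e / 2) ltac:(by rewrite divr_gt0).
have /ltW lu := hM (maxn N M) (leq_maxr _ _).
rewrite -[_ - `|l|](subrKA (u (maxn N M))) (le_trans (ler_normD _ _))//.
rewrite [leRHS]splitr lerD// -[X in `|X - _|]ger0_norm ?u0 ?leq_maxl//.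
by rewrite (le_trans (ler_dist_dist _ _))// distrC.
Qed.

Lemma frame_sum_series f x n :
  series (fun k => `|dot x (f k)| ^+ 2) n = frame_sum f n x.
Proof. by rewrite /series /= big_mkord. Qed.

Lemma frame_sum_le f x n m : (n <= m)%N -> frame_sum f n x <= frame_sum f m x.
Proof.
move=> /subnKC <-; rewrite /frame_sum big_split_ord /= lerDl.
by apply: sumr_ge0 => i _; rewrite exprn_ge0.
Qed.

Lemma frame_sum_limP f x c : cvgn (series (fun k => `|dot x (f k)| ^+ 2)) ->
  let l := limn (series (fun k => `|dot x (f k)| ^+ 2)) in
  (l <= c <-> forall n, frame_sum f n x <= c) /\
  (forall n, c <= frame_sum f n x -> c <= l).
Proof.
move=> cu l; have enl n : frame_sum f n x <= l.
  rewrite -subr_ge0; apply: (@lim_ge0 _ _ n).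
    exact: cvgB cu (cvg_cst (frame_sum f n x)).
  move=> m /(frame_sum_le f x); rewrite -subr_ge0 -[frame_sum f m x]frame_sum_series.
  exact.
split; last by move=> n /le_trans; apply.
split=> [lc n|hc]; first exact: le_trans lc.
rewrite -subr_ge0; apply: (@lim_ge0 _ _ 0 (cvgB (cvg_cst c) cu)) => m _.
by have := hc m; rewrite -subr_ge0 -frame_sum_series; exact.
Qed.

(** The constant is halved because a partial sum need not reach the sum of the
    series. *)
Lemma frame_bounds W f : frame dot W f -> exists A B, [/\ 0 < A, 0 < B,
  forall x n, W x -> frame_sum f n x <= B * `|x| ^+ 2 & lower_bound A W f].
Proof.
move=> [_ [A [B [A0 B0 hAB]]]]; exists (A / 2), B; split=> //.
- by rewrite divr_gt0.
- by move=> x n /hAB[cu _ /(frame_sum_limP _ cu).1]; apply.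
- move=> x /hAB[cu Al _]; apply: contrapT => non.
  have [x0|x0] := eqVneq x 0.
    by apply: non; exists 0%N; rewrite x0 normr0 expr0n mulr0 frame_sum_ge0.
  have x2 : 0 < `|x| ^+ 2 by rewrite exprn_gt0// normr_gt0.
  have : A * `|x| ^+ 2 <= A / 2 * `|x| ^+ 2.
    apply: (le_trans Al); apply/(frame_sum_limP _ cu).1 => n.
    rewrite real_leNgt ?ger0_real ?frame_sum_ge0 ?mulr_ge0 ?invr_ge0//
      ?(ltW A0) ?(ltW x2)//.
    by apply/negP => /ltW hn; apply: non; exists n.
  rewrite ler_pM2r// [leLHS]splitr gerDl => A2.
  by have := lt_le_trans (divr_gt0 A0 (ltr0n K 2)) A2; rewrite ltxx.
Qed.

Lemma bounds_frame W f A B : (forall k, W (f k)) -> 0 < A -> 0 < B ->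
  (forall x, cvgn (series (fun k => `|dot x (f k)| ^+ 2))) ->
  bessel B f -> lower_bound A W f -> frame dot W f.
Proof.
move=> Wf A0 B0 cf hB lb; split=> //; exists A, B; split=> // x Wx u.
have [upper lower] := frame_sum_limP (B * `|x| ^+ 2) (cf x).
split; [exact: cf| |by apply/upper => n; exact: hB].
by have [n hn] := lb _ Wx; exact: (frame_sum_limP _ (cf x)).2 hn.
Qed.

Lemma bounded_operator_gt0 (L : H -> H) : bounded_operator L ->
  exists2 M : K, 0 < M & forall x, `|L x| <= M * `|x|.
Proof.
move=> [M hM]; exists (`|M| + 1) => [|x]; first by rewrite ltr_wpDl.
have hx := hM x; apply: (le_trans hx).
have /ger0_norm <- : 0 <= M * `|x| by exact: le_trans (normr_ge0 _) hx.
by rewrite normrM normr_id ler_wpM2r ?lerDl.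
Qed.

Lemma preimage_subspace (L : H -> H) W : linear L -> bounded_operator L ->
  closed_subspace W -> closed_subspace (L @^-1` W).
Proof.
move=> linL /bounded_operator_gt0[M M0 hM] cW; split.
- by have := linL (-1) 0 0; rewrite scaler0 addr0 scaleN1r addNr /= => ->; case: cW.
- by move=> a x y /= Wx Wy; rewrite linL; exact: subspaceZD.
- move=> x /closureP hx; apply: (subspace_closure cW) => e e0.
  have [a Wa xa] := hx (e / M) ltac:(by rewrite divr_gt0).
  exists (L a) => //; rewrite addrC -scaleN1r -linL scaleN1r addrC.
  rewrite (le_lt_trans (hM _))//.
  by rewrite mulrC -ltr_pdivlMr.
Qed.

(** One step of the frame algorithm, truncated to a finite sum. With
    [y = B^-1 * sum_(k < n) <x, L f_k> f_k] and [E >= A |x|^2] the partial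
    sum of [|<x, L f_k>|^2], expanding the square gives
    [|x - L y|^2 <= |x|^2 - E / B <= (1 - A / B) |x|^2], and
    [1 - 2 t <= (1 + t)^-2] with [t = A / (2 B)]. *)
Lemma approximate_preimage f (L : {linear H -> H}) A B W x :
  0 < A -> 0 < B -> bessel B f -> bessel B (L \o f) ->
  lower_bound A W (L \o f) -> W x ->
  exists y, [/\ Defs.span (range f) y, `|y| <= `|x| &
    (1 + A / B / 2) * `|x - L y| <= `|x|].
Proof.
move=> A0 B0 hf hg lb Wx; have [n hn] := lb _ Wx.
pose c k := dot x (L (f k)).
set v := \sum_(k < n) c k *: f k; set w := \sum_(k < n) c k *: (L \o f) k.
have Lv : L v = w.
  by rewrite linear_sum; apply: eq_bigr => k _; rewrite linearZ.
set E := frame_sum (L \o f) n x in hn.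
have vE : `|v| ^+ 2 <= B * E by exact: bessel_synthesis.
have wE : `|w| ^+ 2 <= B * E by exact: bessel_synthesis.
have xw : dot x w = E.
  rewrite (dot_sumr _ _ (fun k => c k *: (L \o f) k)); apply: eq_bigr => k _.
  by rewrite dotZr mulrC conjM.
have wx : dot w x = E.
  rewrite (dot_suml _ _ (fun k => c k *: (L \o f) k)); apply: eq_bigr => k _.
  by rewrite dotZl [dot _ x]dotC conjM.
have Bn : B != 0 by rewrite gt_eqF.
exists (B^-1 *: v); split.
- exists n, (fun k => B^-1 * c k), (fun k => f k); split=> [k|]; first by exists k.
  by rewrite scaler_sumr; apply: eq_bigr => k _; rewrite scalerA.
- rewrite -ler_sqr ?qualifE/= ?normr_ge0// normrZ exprMn gtr0_norm ?invr_gt0//.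
  rewrite exprVn mulrC ler_pdivrMr ?exprn_gt0// (le_trans vE)//.
  by rewrite mulrC expr2 mulrA ler_pM2r// mulrC; exact: hg.
set t := A / B / 2; have t0 : 0 < t by rewrite !divr_gt0.
have r2 : `|x - L (B^-1 *: v)| ^+ 2 <= (1 - 2 * t) * `|x| ^+ 2.
  rewrite linearZ Lv normB_sqr normrZ dotZl dotZr xw wx.
  rewrite conj_gt0 ?invr_gt0// gtr0_norm ?invr_gt0//.
  have w2 : (B^-1 * `|w|) ^+ 2 <= B^-1 * E.
    by rewrite exprMn expr2 -mulrA ler_pM2l ?invr_gt0// ler_pdivrMl.
  have tE : 2 * t * `|x| ^+ 2 <= B^-1 * E.
    rewrite /t [2 * _]mulrC divfK ?pnatr_eq0//.
    by rewrite mulrAC [leLHS]mulrC ler_pM2l ?invr_gt0.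
  rewrite mulrBl mul1r -addrA lerD2l lerBlDr (le_trans w2)// addrA.
  by rewrite lerDr addrC subr_ge0.
have t1 : 0 <= 1 + t by rewrite addr_ge0 ?ler01 ?ltW.
rewrite -ler_sqr ?qualifE/= ?normr_ge0 ?mulr_ge0// exprMn.
apply: (le_trans (ler_wpM2l (exprn_ge0 2 t1) r2)).
rewrite mulrA ler_piMl ?exprn_ge0//.
rewrite (_ : _ * _ = 1 - (3 * t ^+ 2 + 2 * t ^+ 3)); last by ring.
by rewrite gerDl oppr_le0 addr_ge0// mulr_ge0 ?ler0n// exprn_ge0// ltW.
Qed.

(** The successive corrections form a series dominated by the residuals [R n],
    which decay geometrically. The potential [(1 + 1/t) * |R n|] decreases by
    at least [|R n|] at each step, so it bounds the tails of the series. *)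
Lemma lower_bound_onto f (L : {linear H -> H}) A B W :
  0 < A -> 0 < B -> bessel B f -> bessel B (L \o f) ->
  bounded_operator L -> closed_subspace W -> (forall k, W (L (f k))) ->
  lower_bound A W (L \o f) ->
  forall x, W x -> exists2 y, closed_span (range f) y & L y = x.
Proof.
move=> A0 B0 hf hg bL cW WLf lb x Wx.
have Wspan y : Defs.span (range f) y -> W (L y).
  apply: (span_min (preimage_subspace (linearP L) bL cW)).
  by move=> _ [k _ <-]; exact: WLf.
have [t t0 /choice[s sP]] : exists2 t : K, 0 < t & forall z, exists y, W z ->
    [/\ Defs.span (range f) y, `|y| <= `|z| & (1 + t) * `|z - L y| <= `|z|].
  exists (A / B / 2) => [|z]; first by rewrite !divr_gt0.
  have [Wz|] := pselect (W z); last by exists 0.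
  by have [y hy] := approximate_preimage A0 B0 hf hg lb Wz; exists y.
have t1 : 0 < 1 + t by rewrite addr_gt0.
pose Y n := iter n (fun y => y + s (x - L y)) 0.
pose R n := x - L (Y n).
have YS n : Y n.+1 = Y n + s (R n) by [].
have RS n : R n.+1 = R n - L (s (R n)) by rewrite /R YS linearD opprD addrA.
have [s0 sZ] := span_subspace (range f).
have Yspan n : Defs.span (range f) (Y n) /\ W (R n).
  elim: n => [|n [IHY IHR]]; first by rewrite /R /Y /= linear0 subr0; split.
  have [ss _ _] := sP _ IHR; split.
    by rewrite YS addrC -[s _]scale1r; exact: sZ.
  by rewrite RS; apply: subspaceB => //; exact: Wspan.
have step n : `|Y n.+1 - Y n| <= `|R n| /\ (1 + t) * `|R n.+1| <= `|R n|.
  have [_ /sP[_ h1 h2]] := Yspan n; split; last by rewrite RS.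
  by rewrite YS addrC addKr.
(* Bernoulli: [1 + n t <= (1 + t)^n]. *)
have Rdecay n : (1 + n%:R * t) * `|R n| <= `|x|.
  elim: n => [|n IH]; first by rewrite mul0r addr0 mul1r /R /Y /= linear0 subr0.
  apply: le_trans IH; have nt : 0 <= 1 + n%:R * t.
    by rewrite addr_ge0 ?ler01// mulr_ge0 ?ler0n// ltW.
  apply: le_trans (ler_wpM2l nt (step n).2); rewrite mulrA ler_wpM2r//.
  rewrite [leRHS](_ : _ = 1 + n.+1%:R * t + n%:R * t ^+ 2); last by ring.
  by rewrite lerDl mulr_ge0 ?ler0n// exprn_ge0// ltW.
have Rsmall e : 0 < e -> exists N, forall n, (N <= n)%N -> `|R n| < e.
  move=> e0; have et : 0 < e * t by rewrite mulr_gt0.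
  have [N hN] := archi (divr_ge0 (normr_ge0 x) (ltW et)); exists N => n Nn.
  have nt : 0 < 1 + n%:R * t by rewrite ltr_wpDr// mulr_ge0 ?ler0n// ltW.
  rewrite -(ltr_pM2l nt) (le_lt_trans (Rdecay n))//.
  move: hN; rewrite ltr_pdivrMr// => /lt_le_trans; apply.
  rewrite [e * t]mulrC mulrA ler_pM2r// ler_wpDl// ler_pM2r// ler_nat.
  exact: Nn.
pose C := 1 + t^-1.
have C0 : 0 < C by rewrite addr_gt0 ?invr_gt0.
have Ystep n k : `|Y (n + k)%N - Y n| + C * `|R (n + k)%N| <= C * `|R n|.
  elim: k => [|k IH]; first by rewrite addn0 subrr normr0 add0r.
  apply: le_trans IH; rewrite addnS; set m := (n + k)%N.
  have [h1 h2] := step m.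
  have -> : C * `|R m| = `|R m| + t^-1 * `|R m| by rewrite /C mulrDl mul1r.
  rewrite addrA lerD//.
    rewrite -[Y m.+1 - _](subrKA (Y m)) (le_trans (ler_normD _ _))//.
    by rewrite [leLHS]addrC lerD2l.
  rewrite ler_pdivlMl// (le_trans _ h2)// mulrA /C mulrDr mulr1 mulfV ?gt_eqF//.
  by rewrite addrC.
have [e e0|y yl] := @cauchy_seq_limit K H Y.
  have [N hN] := Rsmall (e / C / 2) ltac:(by rewrite !divr_gt0).
  have YN i : (N <= i)%N -> `|Y i - Y N| < e / 2.
    move=> /subnKC <-; apply: (@le_lt_trans _ _ (C * `|R N|)).
      by apply: le_trans (Ystep N (i - N)%N); rewrite lerDl mulr_ge0 ?(ltW C0).
    by rewrite mulrC -ltr_pdivlMr// mulrAC; exact: hN.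
  exists N => i j Ni Nj; rewrite -[Y i - _](subrKA (Y N)).
  rewrite (le_lt_trans (ler_normD _ _))// [e]splitr ltrD ?YN//.
  by rewrite distrC YN.
exists y.
  apply/closureP => e /yl[N hN]; exists (Y N); last exact: hN.
  by have [] := Yspan N.
have [M M0 hM] := bounded_operator_gt0 bL.
apply/eqP; rewrite -subr_eq0 -normr_eq0; apply/eqP/le_anti.
rewrite normr_ge0 andbT; apply/ler_addgt0Pl => e e0; rewrite addr0.
have [N1 h1] := Rsmall (e / 2) ltac:(by rewrite divr_gt0).
have [N2 h2] := yl (e / 2 / M) ltac:(by rewrite !divr_gt0).
set n := maxn N1 N2.
have -> : L y - x = L (y - Y n) - R n by rewrite linearB /R opprB addrA subrK.
rewrite (le_trans (ler_normB _ _))// [leRHS]splitr lerD//; last first.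
  by rewrite ltW// h1 ?leq_maxl.
by rewrite (le_trans (hM _))// mulrC -ler_pdivlMr// ltW// h2 ?leq_maxr.
Qed.

(** The case of the identity in [lower_bound_onto]. *)
Lemma lower_bound_complete f A B W : 0 < A -> 0 < B -> bessel B f ->
  closed_subspace W -> (forall k, W (f k)) -> lower_bound A W f ->
  W `<=` closed_span (range f).
Proof.
move=> A0 B0 hB cW Wf lb x Wx.
pose I : {linear H -> H} := GRing.Linear.clone _ _ _ _ (@idfun H) _.
have bI : bounded_operator I by exists 1 => z; rewrite mul1r.
by have [y fy <-] := @lower_bound_onto f I A B W A0 B0 hB hB bI cW Wf lb x Wx.
Qed.

(** * The orbit of a vector under a bounded operator *)

Section Orbit.
Variables (T : {linear H -> H}) (phi : H).
Hypothesis bT : bounded_operator T.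
Let f (k : nat) : H := iter k T phi.

Lemma iter_bounded_linear n :
  exists2 L : {linear H -> H}, bounded_operator L & iter n T = L.
Proof.
elim: n => [|n [L /bounded_operator_gt0[M M0 hM] IH]].
  exists (GRing.Linear.clone _ _ _ _ (@idfun H) _) => //.
  by exists 1 => x; rewrite mul1r.
have [M' M'0 hM'] := bounded_operator_gt0 bT.
exists (GRing.Linear.clone _ _ _ _ (T \o L) _); last by rewrite /= -IH.
exists (M' * M) => x; rewrite (le_trans (hM' _))// -mulrA ler_wpM2l//.
exact: ltW.
Qed.

Lemma tail_spanE N :
  tail_span T phi N = closed_span (range (fun k => f (N + k)%N)).
Proof.
congr closed_span; apply/seteqP; split=> [_ [n /= /subnKC Nn <-]|_ [n _ <-]].
  by exists (n - N)%N; rewrite // /f Nn.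
by exists (N + n)%N; rewrite //= leq_addr.
Qed.

Lemma tail_span_subspace N : closed_subspace (tail_span T phi N).
Proof. exact: closed_span_subspace. Qed.

Lemma orbit_tail_span N n : (N <= n)%N -> tail_span T phi N (f n).
Proof. by move=> Nn; apply: closed_span_incl; exists n. Qed.

Lemma tail_span_subset N M : (N <= M)%N ->
  tail_span T phi M `<=` tail_span T phi N.
Proof.
move=> NM; apply: closed_spanS => _ [n /= Mn <-]; exists n => //=.
exact: leq_trans Mn.
Qed.

(** Solving the relation for the vector at its first nonzero coefficient. *)
Lemma first_dependency (c : nat -> K) m : c m != 0 ->
  (forall k, (k < m)%N -> c k = 0) ->
  series (fun k => c k *: f k) @ \oo --> (0 : H) -> tail_span T phi m.+1 (f m).
Proof.
move=> cm c0 /cvgrPdist_lt cv; have cV := tail_span_subspace m.+1.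
apply: (subspace_closure cV) => e e0.
have [N _ hN] := cv (`|c m| * e) ltac:(by rewrite mulr_gt0 ?normr_gt0).
pose n := (m.+1 + N)%N.
have := hN n (leq_addl _ _).
rewrite sub0r normrN /series /= big_mkord /n big_split_ord /= big_ord_recr /=.
rewrite big1 ?add0r; last by move=> i _; rewrite c0 ?scale0r.
set v := \sum_(i < N) _ => hv; exists (- (c m)^-1 *: v).
  apply: (subspaceZ cV).
  apply: (@subspace_sum _ _ _ cV _ (fun i => c (m.+1 + i)%N *: f (m.+1 + i)%N)) => i.
  by apply: (subspaceZ cV); apply: orbit_tail_span; rewrite leq_addr.
rewrite -(ltr_pM2l (_ : 0 < `|c m|)) ?normr_gt0// -normrZ scalerBr scalerA.
by rewrite mulrN mulfV// scaleN1r opprK.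
Qed.

Hypothesis fr : frame dot setT f.

Lemma orbit_bounds :
  exists A B, [/\ 0 < A, 0 < B, bessel B f & lower_bound A setT f].
Proof.
have [A [B [A0 B0 hB lb]]] := frame_bounds fr.
by exists A, B; split=> // x n; exact: hB.
Qed.

Lemma frame_sum_tail N n x : frame_sum (fun k => f (N + k)%N) n x <= frame_sum f (N + n) x.
Proof.
rewrite {2}/frame_sum big_split_ord /= lerDr.
by apply: sumr_ge0 => i _; rewrite exprn_ge0.
Qed.

(** In the second alternative of [lower_bound_drop_first], [y] belongs to the
    span of the shorter tail and is orthogonal to it, hence vanishes. *)
Lemma tail_lower_bound N : exists2 A, 0 < A &
  lower_bound A (tail_span T phi N) (fun k => f (N + k)%N).
Proof.
elim: N => [|N [A A0 lb]].
  by have [A [B [A0 _ _ lb]]] := orbit_bounds; exists A => // x _; exact: lb.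
have cV := tail_span_subspace N.+1.
have lb' := lower_boundS (tail_span_subset (leqnSn N)) lb.
have [[A' A'0 lbA']|[y Vy [y1 y0]]] := lower_bound_drop_first cV A0 lb'.
  by exists A' => // x /lbA'[n hn]; exists n; under eq_fun do rewrite addSnnS.
suff y00 : y = 0 by move: y1; rewrite y00 dot0l => /eqP; rewrite eq_sym oner_eq0.
apply/eqP; rewrite -normr_eq0 -sqrf_eq0 -hdot; apply/eqP.
move: Vy; rewrite tail_spanE; apply: dot_closed_span_eq0 => _ [k _ <-].
by apply/eqP; rewrite -normr_eq0 dot_normC addSnnS y0 normr0.
Qed.

Lemma image_tail_span N : range (iter N T) = tail_span T phi N.
Proof.
have [A [B [A0 B0 hB lb]]] := orbit_bounds.
have [L bL LE] := iter_bounded_linear N.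
have Lf : L \o f = (fun k => f (N + k)%N).
  by apply/funext => k; rewrite /= -LE /f iterD.
apply/seteqP; split.
  rewrite LE => _ [x _ <-].
  have : closed_span (range f) x.
    by apply: (lower_bound_complete A0 B0 hB _ _ lb) => //; exact: setT_subspace.
  move: x; apply: closed_span_min.
    by apply: preimage_subspace => //; [exact: linearP|exact: tail_span_subspace].
  move=> _ [k _ <-] /=; rewrite -[L _]/((L \o f) k) Lf.
  exact/orbit_tail_span/leq_addr.
have [A' A'0 lb'] := tail_lower_bound N.
have hBL : bessel B (L \o f).
  by move=> x n; rewrite Lf; exact: le_trans (frame_sum_tail _ _ _) (hB _ _).
move=> x Vx; have [y _ <-] : exists2 y, closed_span (range f) y & L y = x.
  apply: (lower_bound_onto A'0 B0 hB hBL bL _ _ _ Vx).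
  - exact: closed_span_subspace.
  - by move=> k; rewrite -[L _]/((L \o f) k) Lf; exact/orbit_tail_span/leq_addr.
  - by rewrite Lf.
by rewrite LE; exists y.
Qed.

Lemma tail_frame V N : tail_span T phi N = V -> frame dot V (fun k => f (N + k)%N).
Proof.
move=> <-; have [A [B [A0 B0 hB lb]]] := orbit_bounds.
have [A' A'0 lb'] := tail_lower_bound N.
apply: (bounds_frame _ A'0 B0 _ _ lb').
- by move=> k; exact/orbit_tail_span/leq_addr.
- move=> x; have [_ [_ [_ [_ _ /(_ x I)[cf _ _]]]]] := fr.
  have -> : series (fun k => `|dot x (f (N + k)%N)| ^+ 2) =
      (fun n => series (fun k => `|dot x (f k)| ^+ 2) (n + N)%N - frame_sum f N x).
    apply/funext => n; rewrite !frame_sum_series /frame_sum addnC big_split_ord /=.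
    by rewrite [RHS]addrC addKr.
  have /cvg_ex[l ul] := cf; apply/cvg_ex; exists (l - frame_sum f N x).
  by apply: cvgB; [rewrite cvg_shiftn|exact: cvg_cst].
- by move=> x n; exact: le_trans (frame_sum_tail _ _ _) (hB _ _).
Qed.

(** Either the tail [f_1, f_2, ...] keeps a lower bound on the whole space, and
    then the range of [T] is everything, or there is a vector [g] with
    [<g, phi> = 1] orthogonal to that tail, and [x - <x, g> phi] lies in the
    range of [T] because this holds on the orbit. *)
Lemma orbit_decomposition x : exists a y, x = a *: phi + T y.
Proof.
have [A [B [A0 B0 hB lb]]] := orbit_bounds.
have cT := setT_subspace H.
have cV1 := tail_span_subspace 1.
have imT z : tail_span T phi 1 z -> exists y, z = T y.
  by rewrite -image_tail_span => -[y _ <-]; exists y.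
have [[A' A'0 lb']|[g _ [g1 g0]]] := lower_bound_drop_first cT A0 lb.
  have hB' : bessel B (fun k => f k.+1).
    by move=> z n; exact: le_trans (frame_sum_tail 1 _ _) (hB _ _).
  have /imT[z zE] : tail_span T phi 1 x.
    by rewrite tail_spanE; exact: (lower_bound_complete A'0 B0 hB' cT _ lb').
  by exists 0, z; rewrite scale0r add0r.
pose P z := z - dot z g *: phi.
have PV : (P @^-1` tail_span T phi 1) x.
  have : tail_span T phi 0 x by rewrite -image_tail_span; exists x.
  move: (x); rewrite tail_spanE; apply: closed_span_min.
    apply: preimage_subspace; last exact: tail_span_subspace.
      move=> a y z; rewrite /P dotDl dotZl scalerDl -scalerA scalerBr opprD.
      by rewrite addrACA.
    exists (1 + `|g| * `|phi|) => z; rewrite (le_trans (ler_normB _ _))// normrZ.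
    rewrite mulrDl mul1r lerD2l mulrAC ler_wpM2r// mulrC.
    exact: dot_bounded.
  move=> _ [k _ <-]; change (tail_span T phi 1 (f k - dot (f k) g *: phi)).
  case: k => [|k].
    have -> : dot (f 0%N) g = 1.
      rewrite dotC g1; apply: conj_gt0; exact: ltr01.
    by rewrite scale1r subrr; case: cV1.
  have -> : dot (f k.+1) g = 0.
    by apply/eqP; rewrite -normr_eq0 dot_normC g0 normr0.
  by rewrite scale0r subr0; exact: orbit_tail_span.
have [y Py] := imT _ PV; exists (dot x g), y.
by rewrite -Py /P addrC subrK.
Qed.

Lemma finite_sum_remainder N x : exists (a : nat -> K) y,
  x = \sum_(k < N) a k *: f k + iter N T y.
Proof.
elim: N => [|N [a [y ->]]]; first by exists (fun=> 0), x; rewrite big_ord0 add0r.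
have [b [z ->]] := orbit_decomposition y; have [L _ LE] := iter_bounded_linear N.
exists (fun k => if (k < N)%N then a k else b), z.
rewrite iterSr big_ord_recr /= ltnn LE linearP -LE addrA; congr (_ + _ + _).
by apply: eq_bigr => k _; rewrite ltn_ord.
Qed.

Lemma tail_finite_codimension N : finite_codimension (tail_span T phi N).
Proof.
exists [seq f k | k <- iota 0 N] => x; have [a [y ->]] := finite_sum_remainder N x.
exists (iter N T y); first by rewrite -image_tail_span; exists y.
rewrite addrK; exists N, (fun k => a k), (fun k => f k); split=> // k.
by apply: map_f; rewrite mem_iota ltn_ord.
Qed.

Lemma overcomplete_dependency : ~ omega_independent f ->
  exists m, tail_span T phi m.+1 (f m).
Proof.
move=> indep; apply: contrapT => nodep; apply: indep => c cv.
elim/ltn_ind => k IH; have [//|ck] := eqVneq (c k) 0.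
by case: nodep; exists k; exact: first_dependency cv.
Qed.

Lemma tail_span_stepP N :
  tail_span T phi N.+1 (f N) <-> image_chain T N = image_chain T N.+1.
Proof.
rewrite /image_chain !image_tail_span; split=> [fN|<-]; last exact: orbit_tail_span.
apply/seteqP; split; last exact: tail_span_subset.
apply: closed_span_min; first exact: closed_span_subspace.
move=> _ [n /= Nn <-]; have [<- //|Nn'] := eqVneq N n.
by apply: orbit_tail_span; rewrite ltn_neqAle Nn'.
Qed.

End Orbit.

(** If [T (T x) = 0], normality gives [|S (T x)|^2 = <S (T (T x)), T x> = 0],
    and then [|T x|^2 = <x, S (T x)> = 0]. *)
Lemma normal_null_chain (T : {linear H -> H}) :
  normal_operator dot T -> null_chain T 1 = null_chain T 2.
Proof.
move=> [S adj TS]; apply/seteqP; split=> x; rewrite /null_chain /=.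
  by move=> ->; rewrite linear0.
move=> TTx; have S0 z : dot (S 0) z = 0 by rewrite dotC -adj dot0r conj0.
have STx : S (T x) = 0.
  by apply/eqP; rewrite -normr_eq0 -sqrf_eq0 -hdot -adj TS TTx S0.
by apply/eqP; rewrite -normr_eq0 -sqrf_eq0 -hdot adj STx dot0r.
Qed.

End InnerProduct.

(** * Image chain and null chain *)

Section Chains.
Variables (K : numFieldType) (H : normedModType K) (T : {linear H -> H}).

Lemma image_chainS N : image_chain T N.+1 = T @` image_chain T N.
Proof. by rewrite /image_chain image_comp. Qed.

Lemma image_chain_stable q : image_chain T q = image_chain T q.+1 ->
  forall N, (q <= N)%N -> image_chain T N = image_chain T q.
Proof.
move=> Eq N /subnKC <-; elim: (N - q)%N => [|d IH]; first by rewrite addn0.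
by rewrite addnS image_chainS IH -image_chainS.
Qed.

(** An element of [W] killed by [T] is [T^p z] with [p] an index at which the
    null chain is stationary, and then [z] is in the kernel of [T^(p+1)], hence of [T^p]. *)
Lemma null_chain_inj (W : set H) : (forall a x y, W x -> W y -> W (a *: x + y)) ->
  (forall N, W `<=` image_chain T N) ->
  finite_chain (null_chain T) -> set_inj W T.
Proof.
move=> WZ WR [p Ep] x y; rewrite !inE => Wx Wy Txy; apply/eqP; rewrite -subr_eq0.
have := WZ (-1) _ _ Wy Wx; rewrite scaleN1r addrC => /(WR p)[z _ zE].
have : null_chain T p.+1 z by rewrite /null_chain /= zE linearB Txy subrr.
by rewrite -Ep /null_chain /= zE => ->.
Qed.

End Chains.

(** * The theorem *)

Unset Implicit Arguments.

Theorem theorem2p6 (R : realType) (K : numFieldType) (conj : K -> K)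
    (hK : hilbert_scalars R conj)
    (H : completeNormedModType K) (dot : {dot H for conj})
    (hdot : forall x : H, dot x x = `|x| ^+ 2)
    (hdim : infinite_dimensional H) (hsep : separable H)
    (T : {linear H -> H}) (hT : bounded_operator T) (phi : H)
    (hphi : overcomplete_frame dot setT (fun n => iter n T phi)) :
  exists q : nat,
    [/\ (* (i) *)
        chain_length (image_chain T) q,
        (* (ii) *)
        forall N : nat,
          tail_span T phi N.+1 (iter N T phi) <-> (q <= N)%N
      & forall N : nat, (q <= N)%N ->
        let V := tail_span T phi N in
        [/\ (* (iii) *)
            (forall M : nat, (q <= M)%N -> tail_span T phi M = V) /\
            finite_codimension V,
            (* (iv) *)
            forall l : nat, frame dot V (fun n => iter (N + l + n) T phi),
            (* (v) *)
            set_fun V V T /\ set_surj V V T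
          & (* (vi) *)
            (finite_chain (null_chain T) -> set_inj V T) /\
            (normal_operator dot T ->
               finite_chain (null_chain T) /\ set_inj V T)]].
Proof.
have conjM := hilbert_scalars_norm hK.
have archi := hilbert_scalars_archimedean hK.
have [fr nonriesz] := hphi.
have imE N : image_chain T N = tail_span T phi N.
  exact: (image_tail_span conjM archi hdot hT fr).
have stepP N := tail_span_stepP conjM archi hdot hT fr N.
have stable_ex : exists N, `[<image_chain T N = image_chain T N.+1>].
  have [m fm] : exists m, tail_span T phi m.+1 (iter m T phi).
    by apply: overcomplete_dependency => indep; exact: nonriesz.
  by exists m; apply/asboolP/stepP.
have [q /asboolP Rq qmin] := ex_minnP stable_ex.
have stable := image_chain_stable Rq.
exists q; split.
- by split=> // M RM; apply: qmin; exact/asboolP.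
- move=> N; rewrite stepP; split=> [RN|qN]; first by apply: qmin; exact/asboolP.
  by rewrite (stable _ qN) (stable N.+1) ?leqW.
move=> N qN V.
have VE M : (q <= M)%N -> tail_span T phi M = V.
  by move=> qM; rewrite /V -!imE (stable _ qM) (stable _ qN).
have TV : T @` V = V by rewrite /V -imE -image_chainS !imE VE// leqW.
have inj : finite_chain (null_chain T) -> set_inj V T.
  apply: null_chain_inj => [a x y|M].
    exact: (subspaceZD (tail_span_subspace T phi N)).
  rewrite -(VE _ (leq_maxl q M)) imE; apply: tail_span_subset; exact: leq_maxr.
split; last first.
- split=> // hnormal; suff fin : finite_chain (null_chain T) by split=> //; exact: inj.
  by exists 1%N; exact: (normal_null_chain hdot hnormal).
- by split=> [x Vx|x]; rewrite -{1}TV //; exists x.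
- move=> l; apply: (tail_frame conjM archi hdot fr).
  by apply: VE; rewrite (leq_trans qN)// leq_addr.
- split; first exact: VE.
  exact: (tail_finite_codimension conjM archi hdot hT fr).
Qed.
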